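(* Let $n \geq 4$. If $\mathcal{A}, \mathcal{B} \subset S_n$ is a cross-intersecting pair of families satisfying $|\mathcal{A}||\mathcal{B}| = ((n-1)!)^2$, then there exist $i, j \in [n]$ such that \[\mathcal{A} = \mathcal{B} = \{\sigma \in S_n : \sigma(i) = j\}.\]
   Context: $S_n$ is the symmetric group on $[n]=\{1,\ldots,n\}$. A pair of families $\mathcal{A},\mathcal{B} \subset S_n$ is cross-intersecting if for every $\sigma \in \mathcal{A}$ and every $\tau \in \mathcal{B}$ there is some $i \in [n]$ with $\sigma(i) = \tau(i)$. *)

(* Defs.v *)
From mathcomp Require Import all_boot all_fingroup.
Set Implicit Arguments. Unset Strict Implicit. Unset Printing Implicit Defensive.

Definition cross_intersecting (n : nat) (A B : {set {perm 'I_n}}) : Prop :=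
  forall s t, s \in A -> t \in B -> exists i : 'I_n, s i = t i.

Definition star (n : nat) (i j : 'I_n) : {set {perm 'I_n}} :=
  [set s : {perm 'I_n} | s i == j].

(* Main.v *)
Require Import Defs.
From mathcomp Require Import all_boot all_order all_algebra all_fingroup.
From mathcomp Require Import all_solvable all_field all_character.
From mathcomp Require Import zify ring.
Set Implicit Arguments. Unset Strict Implicit. Unset Printing Implicit Defensive.
Import Order.TTheory GRing.Theory Num.Theory.

(** For [n >= 5] this is the weighted Hoffman bound for the Cayley graph of
    derangements. Let [delta] be the indicator of the derangements, of density [p].
    Parseval, with the coefficients [p] and [- p] of the trivial and the standard
    character, leaves at most [p - 2 p^2 < p^2] for any other coefficient, because
    [p > 1/3] (Bonferroni). A non-linear irreducible character of [S_n] has degree at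
    least [n - 1], and the coefficient of the sign is [+- (n - 1) / n!]
    (a determinant), so after normalisation every eigenvalue other than those of the
    trivial and standard characters is smaller than [1 / (n - 1)] in absolute value,
    while the standard one is exactly [- 1 / (n - 1)]. In the extremal case this forces
    [A = B] and puts the indicator of [A] in the span of the trivial and standard
    isotypic parts, so that [t |-> #{(s, i) | s in A, s i = t i}] takes one value on [A]
    and another off [A]. Comparing the values at [t] and at [t] composed with
    transpositions then shows that [A] is a star.

    The degree bound is proved by induction on [n]: if the degree is [n - 2], the
    restriction to [S_(n-1)] is irreducible, so the Jucys-Murphy element is scalar;
    taking traces expresses the values at 3-cycles and at products of two disjoint
    transpositions through the value at a transposition, and integrality fails.

    For [n = 4] the eigenvalue bound is attained by other characters, and a small
    exhaustive search replaces it. *)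

(** * The case of four points *)

Lemma card_star n (i j : 'I_n) : #|star i j| = n.-1`!.
Proof.
pose s := tperm i j.
have -> : #|star i j| = #|[set t : 'S_n | t i == i]|.
  rewrite -[RHS](card_imset _ (mulIg s)); apply: eq_card => t.
  apply/idP/imsetP => [|[u]]; rewrite inE => /eqP ti; last first.
    by move=> ->; rewrite inE permM ti tpermL.
  by exists (t * s)%g; rewrite -?mulgA ?tperm2 ?mulg1 // inE permM ti tpermR.
have -> : n.-1 = #|[set~ i]| by rewrite cardsC1 card_ord.
rewrite -card_perm; apply/eq_card => t; rewrite !inE; apply/eqP/subsetP => [ti x|h].
  by rewrite !inE; apply: contra => /eqP->; rewrite ti.
by apply/eqP; have := h i; rewrite !inE eqxx; case: eqP => // _ /(_ isT).
Qed.

Section SmallCase.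

(** Permutations become lists of values so that the search can be run by [vm_compute]. *)
Let word (s : 'S_4) : seq nat := [seq val (s i) | i <- enum 'I_4].

Definition words_agree (l m : seq nat) := has (fun i => nth 0 l i == nth 0 m i) (iota 0 4).

(* A leaf holds all of [A] and everything meeting [A]. *)
Definition leaf_ok (chosen cand : seq (seq nat)) :=
  (size chosen * size cand < 36) ||
  [&& size chosen == 6, size cand == 6 &
      has (fun i => all (fun l => nth 0 l i == i) (chosen ++ cand)) (iota 0 4)].

(* [if] rather than [||]: call-by-value evaluation must not explore pruned branches *)
Fixpoint search_cross (rest chosen cand : seq (seq nat)) : bool :=
  if rest is x :: rest' then
    search_cross rest' chosen cand &&
    (let cand' := [seq m <- cand | words_agree x m] in
     if size cand' < 6 then true else search_cross rest' (x :: chosen) cand')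
  else leaf_ok chosen cand.

(** A sublist [l] of [rest] is one branch of the search. Pruning is sound: filtering only shortens
    the candidates, so a branch that ends with at least 6 of them never falls below 6. *)
Lemma search_crossP rest chosen cand l : search_cross rest chosen cand -> subseq l rest ->
  let cand' := [seq m <- cand | all (words_agree^~ m) l] in
  6 <= size cand' -> leaf_ok (catrev l chosen) cand'.
Proof.
elim: rest chosen cand l => [|x rest IH] chosen cand l /=.
  by move=> ok /eqP-> /=; rewrite filter_predT.
case: l => [|y l] /andP[ok1 ok2].
  by move=> _; apply: (IH _ _ [::] ok1); rewrite sub0seq.
case: eqP => [->{y}|_] sub; last exact: (IH _ _ (y :: l) ok1).
have <- : [seq m <- [seq m <- cand | words_agree x m] | all (words_agree^~ m) l] =
          [seq m <- cand | words_agree x m && all (words_agree^~ m) l].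
  by rewrite -filter_predI; apply: eq_filter => m /=; rewrite andbC.
move=> sz; move: ok2; case: ltnP => [small _|_ ok2]; last exact: (IH _ _ _ ok2).
have := size_filter (fun m => all (words_agree^~ m) l) [seq m <- cand | words_agree x m].
by have := count_size (fun m => all (words_agree^~ m) l) [seq m <- cand | words_agree x m]; lia.
Qed.

Let id4 : seq nat := iota 0 4.
Let words := permutations id4.
Let others := [seq l <- words | l != id4].

Lemma search_others : search_cross others [:: id4] [seq m <- words | words_agree id4 m].
Proof. by vm_compute. Qed.

Let nth_word s (i : 'I_4) : nth 0 (word s) i = s i.
Proof. by rewrite (nth_map i) ?nth_ord_enum // size_enum_ord. Qed.

Let word_inj : injective word.
Proof. by move=> s t st; apply/permP => i; apply: val_inj; rewrite /= -!nth_word st. Qed.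

Let word1 : word 1%g = id4.
Proof.
by rewrite /word /id4 -val_enum_ord; apply: eq_map => i; rewrite perm1.
Qed.

Let word_in s : word s \in words.
Proof.
rewrite mem_permutations -[id4]val_enum_ord /word.
rewrite (map_comp val s); apply: perm_map.
apply: uniq_perm; rewrite ?(map_inj_uniq perm_inj) ?enum_uniq // => i.
by rewrite mem_enum; apply/mapP; exists (s^-1%g i); rewrite ?mem_enum ?permKV.
Qed.

Let agree_word s t : words_agree (word s) (word t) = [exists i, s i == t i].
Proof.
apply/hasP/existsP => [[k]|[i /eqP st]].
  rewrite mem_iota /= add0n => k4; rewrite -[k]/(val (Ordinal k4)) !nth_word => /eqP st.
  by exists (Ordinal k4); apply/eqP/val_inj.
by exists (val i); rewrite ?mem_iota ?add0n ?ltn_ord // !nth_word st.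
Qed.

(** The order of the sizes gives [B] at least 6 elements, the pruning threshold. At the leaf, [A]
    lies among the chosen words and [B] among the surviving candidates, so a product below 36 is
    impossible and the other kind of leaf exhibits the common fixed point. *)
Lemma cross4_id (A B : {set 'S_4}) :
  cross_intersecting A B -> #|A| * #|B| = 36 -> #|A| <= #|B| -> 1%g \in A ->
  exists i : 'I_4, A = star i i /\ B = star i i.
Proof.
move=> AB card_AB leAB A1.
have B6 : 6 <= #|B| by nia.
pose wA := [seq word s | s in A]; pose wB := [seq word s | s in B].
pose l := [seq x <- others | x \in wA].
pose cand := [seq m <- [seq m <- words | words_agree id4 m] | all (words_agree^~ m) l].
have Bcand : {subset wB <= cand}.
  move=> _ /imageP[t tB ->]; rewrite !mem_filter word_in andbT.
  apply/andP; split.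
    apply/allP => x; rewrite mem_filter => /andP[/imageP[s sA ->] _].
    by rewrite agree_word; have [i st] := AB _ _ sA tB; apply/existsP; exists i; rewrite st.
  rewrite -word1 agree_word; have [i st] := AB _ _ A1 tB.
  by apply/existsP; exists i; rewrite st.
have uB : uniq wB by rewrite map_inj_uniq ?enum_uniq.
have szB : #|B| <= size cand.
  by rewrite cardE -(size_map word); apply: uniq_leq_size uB Bcand.
have Acat : {subset wA <= catrev l [:: id4]}.
  move=> _ /mapP[s sA ->]; rewrite catrevE mem_cat mem_rev mem_seq1 !mem_filter word_in.
  have -> : word s \in wA by apply: map_f.
  by case: eqP.
have szA : #|A| <= size (catrev l [:: id4]).
  rewrite cardE -(size_map word); apply: uniq_leq_size Acat.
  by rewrite map_inj_uniq ?enum_uniq.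
have := search_crossP search_others (filter_subseq _ _ : subseq l others) (leq_trans B6 szB).
rewrite /leaf_ok -/cand => /orP[|/and3P[/eqP cA /eqP cB /hasP[k]]].
  by rewrite ltnNge -card_AB leq_mul.
rewrite mem_iota add0n => /= k4 /allP fix_k.
rewrite cA in szA; rewrite cB in szB.
have cB6 : #|B| = 6 by apply/eqP; rewrite eqn_leq szB B6.
have cA6 : #|A| = 6 by move: card_AB; rewrite cB6; lia.
exists (Ordinal k4); split; apply/eqP; rewrite eqEcard card_star ?cA6 ?cB6 andbT.
  apply/subsetP => s sA; rewrite inE; apply/eqP/val_inj; rewrite /= -nth_word /=; apply/eqP.
  by apply: fix_k; rewrite mem_cat Acat //; apply: map_f; rewrite mem_enum.
apply/subsetP => s sB; rewrite inE; apply/eqP/val_inj; rewrite /= -nth_word /=; apply/eqP.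
by apply: fix_k; rewrite mem_cat Bcand ?orbT //; apply: map_f; rewrite mem_enum.
Qed.

Lemma cross4_le (A B : {set 'S_4}) :
  cross_intersecting A B -> #|A| * #|B| = 36 -> #|A| <= #|B| ->
  exists i j : 'I_4, A = star i j /\ B = star i j.
Proof.
move=> AB card_AB leAB.
have [s sA] : exists s, s \in A by apply/card_gt0P; nia.
(* Right translation preserves agreements; this one moves a member of [A] to the identity. *)
pose f (t : 'S_4) := (t * s^-1)%g; have f_inj : injective f := mulIg _.
have [||||i [Ai Bi]] := @cross4_id (f @: A) (f @: B).
- move=> _ _ /imsetP[t tA ->] /imsetP[u uB ->]; have [i tu] := AB _ _ tA uB.
  by exists i; rewrite !permM tu.
- by rewrite !card_imset.
- by rewrite !card_imset.
- by apply/imsetP; exists s; rewrite // /f mulgV.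
have stE t : (f t \in star i i) = (t \in star i (s i)).
  by rewrite !inE permM -(inj_eq (@perm_inj _ s)) permKV.
exists i, (s i); split; apply/setP => t; rewrite -stE.
  by rewrite -Ai mem_imset.
by rewrite -Bi mem_imset.
Qed.

End SmallCase.

Lemma cross4 (A B : {set 'S_4}) :
  cross_intersecting A B -> #|A| * #|B| = 36 ->
  exists i j : 'I_4, A = star i j /\ B = star i j.
Proof.
move=> AB card_AB; have [leAB|ltBA] := leqP #|A| #|B|; first exact: cross4_le.
have [|||i [j [-> ->]]] := @cross4_le B A.
- by move=> t s tB sA; have [i st] := AB _ _ sA tB; exists i.
- by rewrite mulnC.
- exact: ltnW.
by exists i, j.
Qed.

(** * Two-valued sums over permutations *)

(** Pairwise intersecting edges form a star or a triangle. Ordered pairs are counted: a triangle has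
    6, fewer than [2 * n.-1], and a star with [2 * n.-1] of them is full. *)
Lemma star_edges (n : nat) (e : rel 'I_n) : 5 <= n ->
  symmetric e -> irreflexive e ->
  (forall i j i' j', e i j -> e i' j' -> [|| i == i', i == j', j == i' | j == j']) ->
  #|[set p : 'I_n * 'I_n | e p.1 p.2]| = 2 * n.-1 ->
  exists c, forall i j, i != j -> e i j = (i == c) || (j == c).
Proof.
move=> n5 esym eirr emeet ecard.
have [c ec|noc] := pickP (fun c => [forall i, forall j, e i j ==> ((i == c) || (j == c))]).
  have {}ec i j : e i j -> (i == c) || (j == c).
    by move: ec => /forallP/(_ i)/forallP/(_ j)/implyP; apply.
  exists c => i j ij.
  pose S := [set p : 'I_n * 'I_n | (p.1 != p.2) && ((p.1 == c) || (p.2 == c))].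
  have cS : #|S| <= 2 * n.-1.
    have : S \subset [set (c, j) | j in [set~ c]] :|: [set (j, c) | j in [set~ c]].
      apply/subsetP => -[x y]; rewrite !inE /= => /andP[xy /orP[/eqP xc|/eqP yc]].
        by apply/orP; left; apply/imsetP; exists y; rewrite ?xc // !inE -xc eq_sym.
      by apply/orP; right; apply/imsetP; exists x; rewrite ?yc // !inE -yc.
    move/subset_leq_card/leq_trans; apply.
    apply: leq_trans (leq_card_setU _ _) _; rewrite mul2n -addnn.
    by apply: leq_add; apply: leq_trans (leq_imset_card _ _) _; rewrite cardsC1 card_ord.
  have sub : [set p : 'I_n * 'I_n | e p.1 p.2] \subset S.
    apply/subsetP => -[x y]; rewrite !inE /= => exy; rewrite ec // andbT.
    by apply: contraTN exy => /eqP->; rewrite eirr.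
  have /eqP/setP/(_ (i, j)) : [set p : 'I_n * 'I_n | e p.1 p.2] == S.
    by rewrite eqEcard sub ecard.
  by rewrite !inE /= ij.
have [ab eab] : exists p : 'I_n * 'I_n, e p.1 p.2.
  have /card_gt0P[p] : 0 < #|[set p : 'I_n * 'I_n | e p.1 p.2]| by rewrite ecard; lia.
  by rewrite inE; exists p.
case: ab eab => a b /= eab.
have ex c : exists x y, [/\ e x y, x != c & y != c].
  move/negbT: (noc c); rewrite negb_forall => /existsP[x]; rewrite negb_forall => /existsP[y].
  by rewrite negb_imply negb_or => /and3P[? ? ?]; exists x, y.
(* An edge avoiding [b] meets [ab] in [a], and one avoiding [a] meets it in [b]. These two edges
   meet each other, which closes a triangle, and an edge that meets all three sides is one of
   them. *)
have [c [eac cb]] : exists c, e a c /\ c != b.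
  have [x [y [exy xb yb]]] := ex b; have := emeet _ _ _ _ eab exy.
  case/or4P => /eqP ?; subst; rewrite ?eqxx // in xb yb *; first by exists y.
  by exists x; rewrite esym.
have [d [ebd da]] : exists d, e b d /\ d != a.
  have [x [y [exy xb yb]]] := ex a; have := emeet _ _ _ _ eab exy.
  case/or4P => /eqP ?; subst; rewrite ?eqxx // in xb yb *; first by exists y.
  by exists x; rewrite esym.
have ab : a != b by apply: contraTN eab => /eqP->; rewrite eirr.
have ac : a != c by apply: contraTN eac => /eqP->; rewrite eirr.
have cd : c = d.
  have := emeet _ _ _ _ eac ebd; rewrite (negbTE ab) (eq_sym a) (negbTE da) (negbTE cb) /=.
  by move/eqP.
subst d; suff : #|[set p : 'I_n * 'I_n | e p.1 p.2]| <= 6 by rewrite ecard; lia.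
have /subset_leq_card/leq_trans : [set p : 'I_n * 'I_n | e p.1 p.2] \subset
   [:: (a, b); (b, a); (a, c); (c, a); (b, c); (c, b)].
  apply/subsetP => -[x y]; rewrite !inE /= => exy; rewrite !xpair_eqE.
  have h1 := emeet _ _ _ _ eac exy; have h2 := emeet _ _ _ _ ebd exy.
  have ba := ab; rewrite eq_sym in ba; have ca := ac; rewrite eq_sym in ca.
  have bc := cb; rewrite eq_sym in bc.
  case/or4P: (emeet _ _ _ _ eab exy) => /eqP e0; [rewrite -e0 in h2 *|rewrite -e0 in h2 *|
    rewrite -e0 in h1 *|rewrite -e0 in h1 *].
  - by case/or4P: h2 => /eqP h2; move: ba ca; rewrite h2 ?eqxx ?orbT.
  - by case/or4P: h2 => /eqP h2; move: ba ca; rewrite h2 ?eqxx ?orbT.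
  - by case/or4P: h1 => /eqP h1; move: ab cb; rewrite h1 ?eqxx ?orbT.
  - by case/or4P: h1 => /eqP h1; move: ab cb; rewrite h1 ?eqxx ?orbT.
by apply; apply: leq_trans (card_size _) _.
Qed.

Local Open Scope ring_scope.

(** From a member of [A], a swap of two values lowers the sum by [k] if it leaves [A] and by 0
    otherwise; the change involves only the two points swapped. Two disjoint swaps that both leave
    [A] would together produce the sum [v - k], which is not a possible value. *)
Lemma star_of_two_valued n (A : {set 'S_n}) (w : 'I_n -> 'I_n -> int) (v k : int) :
    (5 <= n)%N -> k != 0 ->
    (forall s : 'S_n, \sum_i w i (s i) = v + k *+ (s \in A)) ->
    \sum_i \sum_j w i j = v *+ n + k -> #|A| = (n.-1)`! ->
  exists i j, A = star i j.
Proof.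
move=> n5 k0 wA wsum cA.
pose W (s : 'S_n) := \sum_i w i (s i).
pose D (s : 'S_n) i j := w i (s i) + w j (s j) - w i (s j) - w j (s i).
have WD (s : 'S_n) i j : W s - W (tperm i j * s)%g = D s i j.
  have [<-|ij] := eqVneq i j; first by rewrite tperm1 mul1g /D; ring.
  rewrite /W (bigD1 i) //= (bigD1 j) 1?eq_sym //=.
  rewrite [X in _ - X](bigD1 i) //= [X in _ - (_ + X)](bigD1 j) 1?eq_sym //=.
  rewrite !permM tpermL tpermR.
  rewrite [X in _ - (_ + (_ + X))](eq_bigr (fun x => w x (s x))); last first.
    by move=> x /andP[xi xj]; rewrite permM tpermD // eq_sym.
  rewrite /D; ring.
have DA s i j : s \in A -> D s i j = k *+ ((tperm i j * s)%g \notin A).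
  by move=> sA; rewrite -WD /W !wA sA; case: (_ \in A) => /=; rewrite ?mulr1n ?mulr0n; ring.
have Ddisj s i j x y : x != i -> x != j -> y != i -> y != j ->
    D (tperm i j * s)%g x y = D s x y.
  by move=> *; rewrite /D !permM !tpermD // eq_sym.
(* The swaps that lead out of [A] are pairwise intersecting edges, and there are
   [n - 1 >= 4] of them: they form a full star of [K_n]. *)
have center s : s \in A -> exists c, forall i j, i != j ->
    ((tperm i j * s)%g \notin A) = (i == c) || (j == c).
  move=> sA; apply: (star_edges (e := fun i j => (tperm i j * s)%g \notin A)) => //.
  - by move=> i j /=; rewrite tpermC.
  - by move=> i /=; rewrite tperm1 mul1g sA.
  - move=> i j i' j' /= eij eij'; apply: contraT; rewrite !negb_or => /and4P[? ? ? ?].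
    have := WD (tperm i j * s)%g i' j'; rewrite Ddisj 1?eq_sym //.
    rewrite !DA // eij' mulr1n /W !wA (negbTE eij) mulr0n.
    by case: (_ \in A); rewrite /= ?mulr0n ?mulr1n => /eqP; move: k0; lia.
  (* Each ordered pair whose swap leaves [A] contributes [k], so this total counts those pairs. *)
  have : \sum_i \sum_j D s i j = (2 * n.-1)%:R * k.
    have -> : \sum_i \sum_j D s i j = 2%:R * (n%:R * W s - \sum_i \sum_j w i j).
      under eq_bigr do rewrite !big_split /= !sumrN.
      rewrite !big_split /= !sumrN.
      have -> : \sum_i \sum_(j < n) w i (s i) = n%:R * W s.
        under eq_bigr do rewrite sumr_const card_ord -mulr_natl.
        by rewrite -mulr_sumr.
      have -> : \sum_(i < n) \sum_j w j (s j) = n%:R * W s.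
        by rewrite mulr_natl sumr_const card_ord.
      have e1 i : \sum_j w i (s j) = \sum_j w i j.
        by rewrite [RHS](reindex_inj (@perm_inj _ s)).
      rewrite (eq_bigr _ (fun i _ => e1 i)).
      rewrite [X in _ - _ - X]exchange_big /= (eq_bigr _ (fun i _ => e1 i)).
      ring.
    rewrite /W wA sA wsum -mulr_natl mulr1n; case: (n) n5 => // m _.
    by rewrite /= natrM -[in LHS]natr1; ring.
  rewrite pair_big /= (eq_bigr (fun p => k *+ ((tperm p.1 p.2 * s)%g \notin A))); last first.
    by move=> p _; rewrite DA.
  rewrite sumrMnr -[LHS]mulr_natl => h; have /eqP := mulIf k0 h; rewrite eqr_nat => /eqP <-.
  by rewrite -sum1_card big_mkcond /=; apply: eq_bigr => p _; rewrite inE; case: (_ \notin A).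
have [s sA] : exists s, s \in A by apply/card_gt0P; rewrite cA fact_gt0.
have [c sc] := center s sA.
suff sub (t : 'S_n) : t c = s c -> t \in A.
  exists c, (s c); apply/esym/eqP; rewrite eqEcard; apply/andP; split.
    by apply/subsetP => t; rewrite inE => /eqP; apply: sub.
  by rewrite cA card_star.
move: {2}#|[set x | t x != s x]| (leqnn #|[set x | t x != s x]|) => m.
elim: m s sA sc => [|m IH] s sA sc dm tc.
  suff -> : t = s by [].
  apply/permP => x; apply/eqP; move: dm; rewrite leqn0 cards_eq0 => /eqP/setP/(_ x).
  by rewrite !inE => /negbFE.
have [j tj|same] := pickP (fun x => t x != s x); last first.
  by suff -> : t = s by []; apply/permP => x; apply/eqP/negbFE/same.
(* The swap of [j] and [l] avoids [c], hence stays in [A]. It repairs [j] and breaks no agreement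
   with [t], since [l] is already a disagreement. *)
pose l := (s^-1)%g (t j).
have sl : s l = t j by rewrite permKV.
have jl : j != l by apply: contraNN tj => /eqP {2}->; rewrite sl.
have jc : j != c by apply: contraNN tj => /eqP->; rewrite tc.
have lc : l != c.
  by apply: contraNN jc => /eqP lc; apply/eqP/(@perm_inj _ t); rewrite tc -sl lc.
have s'A : (tperm j l * s)%g \in A.
  by apply/negbFE; rewrite sc // (negbTE jc) (negbTE lc).
apply: (IH (tperm j l * s)%g) => //; last by rewrite permM tpermD // eq_sym.
  (* The centre does not move: otherwise the swap of [c'] with a fifth point [x] would leave [A]
     after the swap of [j] and [l] but not before it, although both changes of the sum are equal by
     [Ddisj]. *)
  have [c' sc'] := center _ s'A; suff -> : c = c' by [].
  apply/eqP/negPn/negP => cc'.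
  have := sc' j l jl; rewrite mulgA tperm2 mul1g sA /= => /esym/negbT.
  rewrite negb_or => /andP[jc' lc'].
  have [x] : exists x, x \notin [:: j; l; c; c'].
    apply/existsP; rewrite -negb_forall; apply/negP => /forallP h.
    have : (#|'I_n| <= #|[:: j; l; c; c']|)%N by apply/subset_leq_card/subsetP => x _; apply: h.
    rewrite card_ord => /leq_trans/(_ (card_size _)) /=; lia.
  rewrite !inE !negb_or => /and4P[xj xl xc xc'].
  have := Ddisj s j l c' x; rewrite ![c' == _]eq_sym => /(_ jc' lc' xj xl).
  rewrite !DA // sc' ?sc ?eqxx 1?eq_sym //= (eq_sym c') (negbTE cc') (negbTE xc) /=.
  by move/eqP; apply/negP.
have : [set x | t x != (tperm j l * s)%g x] \subset [set x | t x != s x] :\ j.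
  apply/subsetP => x; rewrite !inE permM.
  case: tpermP => [->|->|xj xl]; first by rewrite sl eqxx.
    by move=> _; rewrite eq_sym jl sl (inj_eq (@perm_inj _ t)) eq_sym jl.
  by move=> ->; rewrite andbT; apply/eqP.
move/subset_leq_card/leq_trans; apply.
by rewrite (cardsD1 j) inE tj in dm.
Qed.

(** * Degrees of the irreducible characters of the symmetric group *)

Local Notation Sym n := [set: {perm 'I_n}]%G.

(** The multiplicity of the trivial character in the restriction to [<[x]>] is
    [(chi 1 + (p - 1) chi x) / p]. Hence [chi x] is rational, and as an algebraic integer it is an
    integer. *)
Lemma char_prime_rational (gT : finGroupType) (G : {group gT}) (chi : 'CF(G)) x p :
    chi \is a character -> x \in G -> prime p -> #[x]%g = p ->
    (forall k, (0 < k < p)%N -> chi (x ^+ k)%g = chi x) ->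
  exists z : int, chi x = z%:~R /\
    exists m : nat, chi 1%g + p.-1%:R * chi x = p%:R * m%:R.
Proof.
move=> Nchi Gx pp ox chiX.
have sxG : <[x]>%g \subset G by rewrite cycle_subG.
have xn1 : (x != 1)%g by rewrite -order_gt1 ox prime_gt1.
have [m Dm] : exists m : nat, chi 1%g + p.-1%:R * chi x = p%:R * m%:R.
  have /natrP[m Dm] : '['Res[<[x]>] chi, 1] \in Num.nat.
    by rewrite Cnat_cfdot_char ?cfRes_char ?rpred1.
  exists m; rewrite -Dm cfdotE -orderE ox mulrA divff ?mul1r; last first.
    by rewrite pnatr_eq0 -lt0n prime_gt0.
  rewrite (bigD1 1%g) //= cfResE // cfun1E group1 rmorph1 mulr1; congr (_ + _).
  rewrite (eq_bigr (fun _ => chi x)); last first.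
    move=> y /andP[/cycleP[k ->] xk1].
    rewrite cfResE // ?mem_cycle // cfun1E mem_cycle rmorph1 mulr1 -expg_mod_order ox chiX //.
    rewrite ltn_mod (prime_gt0 pp) lt0n andbT; apply: contraNneq xk1 => k0.
    by rewrite -expg_mod_order ox k0.
  rewrite sumr_const -[RHS]mulr_natl; congr (_%:R * _).
  have := cardsD1 1%g <[x]>%g; rewrite group1 -orderE ox => ->.
  by rewrite add1n /=; apply: eq_card => y; rewrite !inE andbC.
have /intrP[z Dz] : chi x \in Num.int.
  apply: Cint_rat_Aint; last exact: Aint_char.
  have -> : chi x = (p%:R * m%:R - chi 1%g) / p.-1%:R.
    rewrite -Dm addrC addKr mulrC mulKf // pnatr_eq0 -lt0n -subn1 subn_gt0 prime_gt1 //.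
  have /natrP[d ->] := Cnat_char1 Nchi.
  by rewrite rpredM ?rpredV ?rpredB ?rpredM ?rpred_nat.
by exists z; split=> //; exists m.
Qed.

Lemma perm_map_uniq (T : finType) (xs ys : seq T) :
  uniq xs -> uniq ys -> size xs = size ys -> exists s : {perm T}, map s xs = ys.
Proof.
elim: xs ys => [|x xs IH] [|y ys] //=; first by exists 1%g.
move=> /andP[xxs uxs] /andP[yys uys] [sz].
have [s ds] := IH ys uxs uys sz; exists (s * tperm (s x) y)%g.
rewrite permM tpermL; congr (_ :: _); rewrite -[RHS]ds; apply/eq_in_map => z zxs.
rewrite permM tpermD //; first by apply: contraNneq xxs => /perm_inj->.
by apply: contraNneq yys => ->; rewrite -ds map_f.
Qed.

(** * Conjugacy and integrality at transpositions, 3-cycles and double transpositions *)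

Section SymChar.

Variable n : nat.
Implicit Types (x y z : 'I_n) (chi : 'CF(Sym n)).

Lemma cfun_tperm chi x y x' y' : x != y -> x' != y' -> chi (tperm x y) = chi (tperm x' y').
Proof.
move=> xy xy'; have [|||s /= [<- <-]] := @perm_map_uniq _ [:: x; y] [:: x'; y'].
- by rewrite /= inE xy.
- by rewrite /= inE xy'.
- by [].
by rewrite -tpermJ cfunJ ?inE.
Qed.

Lemma cfun_3cycle chi x y z x' y' z' : uniq [:: x; y; z] -> uniq [:: x'; y'; z'] ->
  chi (tperm x y * tperm y z)%g = chi (tperm x' y' * tperm y' z')%g.
Proof.
move=> u u'; have [//|s /= [<- <- <-]] := perm_map_uniq u u'.
by rewrite -!tpermJ -conjMg cfunJ ?inE.
Qed.

Lemma cfun_22cycle chi x y z w x' y' z' w' :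
  uniq [:: x; y; z; w] -> uniq [:: x'; y'; z'; w'] ->
  chi (tperm x y * tperm z w)%g = chi (tperm x' y' * tperm z' w')%g.
Proof.
move=> u u'; have [//|s /= [<- <- <- <-]] := perm_map_uniq u u'.
by rewrite -!tpermJ -conjMg cfunJ ?inE.
Qed.

Lemma order_tperm x y : x != y -> #[tperm x y]%g = 2.
Proof.
move=> xy; apply: nt_prime_order => //; first by rewrite expgS expg1 tperm2.
by apply: contraNneq xy => e; rewrite -{1}(tpermR x y) e perm1.
Qed.

Lemma order_22cycle x y z w : uniq [:: x; y; z; w] -> #[tperm x y * tperm z w]%g = 2.
Proof.
rewrite /= !inE !negb_or => /and4P[/and3P[xy xz xw] /andP[yz yw] zw _].
apply: nt_prime_order => //.
  have -> : ((tperm x y * tperm z w) ^+ 2 = tperm x y * tperm x y ^ tperm z w)%g.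
    by rewrite conjgE tpermV expgS expg1 !mulgA.
  by rewrite tpermJ !tpermD 1?eq_sym // tperm2.
apply: contraNneq xy => /permP/(_ y); rewrite perm1 permM tpermR tpermD 1?eq_sym //.
by move->.
Qed.

Lemma cycle3_inv x y z : (tperm x y * tperm y z)^-1%g = (tperm z y * tperm y x)%g.
Proof. by rewrite invMg !tpermV tpermC [tperm x y]tpermC. Qed.

Lemma order_3cycle x y z : uniq [:: x; y; z] -> #[tperm x y * tperm y z]%g = 3.
Proof.
rewrite /= !inE !negb_or => /and3P[/andP[xy xz] yz _].
have gx : (tperm x y * tperm y z)%g x = z by rewrite permM !tpermL.
have gy : (tperm x y * tperm y z)%g y = x by rewrite permM tpermR tpermD // eq_sym.
have gz : (tperm x y * tperm y z)%g z = y by rewrite permM (tpermD xz yz) tpermR.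
have gw w : w != x -> w != y -> w != z -> (tperm x y * tperm y z)%g w = w.
  by move=> wx wy wz; rewrite permM !tpermD // eq_sym.
move: (tperm x y * tperm y z)%g gx gy gz gw => g gx gy gz gw.
apply: nt_prime_order => //.
  apply/permP => w; rewrite perm1 !expgS expg0 mulg1 !permM.
  have [->|wx] := eqVneq w x; first by rewrite gx gz gy.
  have [->|wy] := eqVneq w y; first by rewrite gy gx gz.
  have [->|wz] := eqVneq w z; first by rewrite gz gy gx.
  by rewrite !gw.
by apply: contraNneq xz => /permP/(_ x); rewrite gx perm1 => ->.
Qed.

(** Puts 3-cycles in the derived subgroup, on which linear characters are trivial. *)
Lemma commg_tperm x y z : uniq [:: x; y; z] ->
  [~ tperm y z, tperm x y]%g = (tperm x y * tperm y z)%g.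
Proof.
rewrite /= !inE !negb_or => /and3P[/andP[xy xz] yz _].
have -> : [~ tperm y z, tperm x y]%g = (tperm x y ^ tperm y z * tperm x y)%g.
  by rewrite /commg !conjgE !tpermV !mulgA.
by rewrite conjgC tpermJ tpermL tpermD 1?eq_sym // tpermJ tpermL tpermD // eq_sym.
Qed.

Lemma char_tperm_int chi x y : chi \is a character -> x != y ->
  exists z : int, chi (tperm x y) = z%:~R.
Proof.
move=> Nchi xy; have [||||z [Dz _]] := @char_prime_rational _ _ chi (tperm x y) 2 Nchi.
- by rewrite inE.
- by [].
- exact: order_tperm.
- by case=> [|[|[|]]].
by exists z.
Qed.

Lemma char_22cycle_int chi x y z w : chi \is a character -> uniq [:: x; y; z; w] ->
  exists k : int, chi (tperm x y * tperm z w)%g = k%:~R.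
Proof.
move=> Nchi u.
have [||||k [Dk _]] := @char_prime_rational _ _ chi (tperm x y * tperm z w)%g 2 Nchi.
- by rewrite inE.
- by [].
- exact: order_22cycle.
- by case=> [|[|[|]]].
by exists k.
Qed.

Lemma char_3cycle_int chi x y z : chi \is a character -> uniq [:: x; y; z] ->
  exists k : int, chi (tperm x y * tperm y z)%g = k%:~R.
Proof.
move=> Nchi u.
have [||||k [Dk _]] := @char_prime_rational _ _ chi (tperm x y * tperm y z)%g 3 Nchi.
- by rewrite inE.
- by [].
- exact: order_3cycle.
- case=> [|[|[|]]] // _.
  rewrite (_ : _ ^+ 2 = (tperm x y * tperm y z)^-1)%g.
    by rewrite cycle3_inv (@cfun_3cycle _ z y x x y z) // -rev_uniq.
  apply/eqP; rewrite eq_sym eq_invg_mul -[X in (X * _)%g]expg1 -expgD.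
  by have := expg_order (tperm x y * tperm y z)%g; rewrite (order_3cycle u) => ->.
by exists k.
Qed.

(** By normality [K] contains every 3-cycle, so all transpositions through [x] have the same image
    modulo [K]. They generate, hence the quotient is cyclic. *)
Lemma der1_Sym_sub (K : {group {perm 'I_n}}) x y z :
  (K <| Sym n)%g -> uniq [:: x; y; z] -> (tperm x y * tperm y z)%g \in K ->
  ((Sym n)^`(1) \subset K)%g.
Proof.
move=> nK u Kxyz.
have K3 x' y' z' : uniq [:: x'; y'; z'] -> (tperm x' y' * tperm y' z')%g \in K.
  move=> u'; have [//|s /= [<- <- <-]] := perm_map_uniq u u'.
  by rewrite -!tpermJ -conjMg memJ_norm // (subsetP (normal_norm nK)) ?inE.
apply: der1_min; first exact: normal_norm.
have [xy yz] : x != y /\ y != z.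
  by move: u; rewrite /= !inE !negb_or => /and3P[/andP[-> _] -> _].
have nKT := subsetP (normal_norm nK).
suff -> : (Sym n / K = <[coset K (tperm x y)]>)%g by apply: cycle_abelian.
apply/eqP; rewrite eqEsubset cycle_subG mem_quotient ?inE // andbT.
rewrite /= -(gen_tperm x) quotient_gen; last by apply/subsetP => s _; rewrite nKT ?inE.
rewrite gen_subG; apply/subsetP => _ /morphimP[s _ /imsetP[w _ ->] ->].
have [<-|xw] := eqVneq x w; first by rewrite tperm1 morph1 group1.
have [<-|yw] := eqVneq y w; first exact: cycle_id.
suff e : coset K (tperm x w) = coset K (tperm x y) by rewrite /= e cycle_id.
apply/esym/rcoset_kercosetP; rewrite ?nKT ?inE //.
rewrite mem_rcoset tpermV tpermC K3 //= !inE !negb_or xw yw; by rewrite eq_sym xy.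
Qed.

Lemma irr_3cycle_linear i x y z : uniq [:: x; y; z] ->
  'chi[Sym n]_i (tperm x y * tperm y z)%g = 'chi_i 1%g -> 'chi_i \is a linear_char.
Proof.
move=> u e; rewrite lin_irr_der1; apply: (der1_Sym_sub _ u); first exact: cfker_normal.
by rewrite /= cfkerEirr inE e.
Qed.

End SymChar.

(* All non-trivial powers of a 5-cycle are conjugate, so its non-trivial eigenvalues
   come in groups of four. *)
Lemma irr_Sym5_degree i : 'chi[Sym 5]_i 1%g < 4 -> 'chi_i \is a linear_char.
Proof.
(* Arithmetic modulo 5 on the five points: [c] is the shift by 1, and the doubling map [m]
   conjugates it to its square. *)
pose c : {perm 'Z_5} := perm (addIr 1).
have c1 x : c x = x + 1 by rewrite permE.
have cX k x : (c ^+ k)%g x = x + k%:R.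
  elim: k x => [|k IH] x; first by rewrite expg0 perm1 addr0.
  by rewrite expgSr permM IH c1 -addrA natr1.
have m_inj : injective (fun x : 'Z_5 => x * 2).
  apply: (can_inj (g := fun x => x * 3)) => x /=.
  by rewrite -mulrA (_ : 2 * 3 = 1 :> 'Z_5) ?mulr1 //; apply: val_inj.
pose m : {perm 'Z_5} := perm m_inj.
have cm : (c ^ m = c ^+ 2)%g.
  apply/permP => y; rewrite -[y](permKV m) permJ cX c1 !permE.
  by rewrite mulrDl mul1r.
have oc : #[c]%g = 5.
  apply: nt_prime_order => //; first by apply/permP => x; rewrite cX perm1 char_Zp ?addr0.
  by apply/eqP => /permP/(_ 0); rewrite c1 perm1 add0r.
set chi := 'chi_i => d4.
have [|//|//||z [Dz [k Dk]]] := @char_prime_rational _ _ chi c 5 (irr_char i).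
- by rewrite inE.
- have J k x : chi (c ^+ k ^ x)%g = chi (c ^+ k)%g by rewrite cfunJ ?inE.
  have e2 : chi (c ^+ 2)%g = chi c by rewrite -cm (J 1%N).
  have e4 : chi (c ^+ 4)%g = chi c by rewrite (expgM c 2 2) -{1}cm -conjXg J e2.
  have e3 : chi (c ^+ 3)%g = chi c.
    have -> : (c ^+ 3 = (c ^+ 2) ^+ 4)%g by rewrite -expgM -[RHS]expg_mod_order oc.
    by rewrite -{1}cm -conjXg J e4.
  by case=> [|[|[|[|[|]]]]].
have /natrP[d Dd] : chi 1%g \in Num.nat by apply: Cnat_irr1.
(* [d + 4 z] is a nonnegative multiple of 5 and [|z| <= d <= 3], which leaves only [z = d]: the
   5-cycle lies in the kernel. *)
have zd : z = d.
  move: Dk d4 (char1_ge_norm c (irr_char i)); rewrite -/chi Dz Dd => Dk d4.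
  rewrite -[d%:R]/((d : int)%:~R) -intr_norm ler_int => zd.
  rewrite ltr_nat in d4.
  have {}Dk : d%:Z + 4 * z = 5 * k%:Z.
    by apply: (@intr_inj algC); rewrite intrD !intrM; exact: Dk.
  by move: zd Dk d4; lia.
have Kc : c \in cfker chi by rewrite cfkerEirr inE -/chi Dz Dd zd.
have nK := normal_norm (cfker_normal chi).
pose a0 : 'I_5 := (0%R : 'Z_5); pose a1 : 'I_5 := (1%R : 'Z_5); pose a2 : 'I_5 := (2%R : 'Z_5).
pose t : {perm 'I_5} := tperm a0 a1.
have K3 : (tperm a2 a1 * tperm a1 a0)%g \in cfker chi.
  have -> : (tperm a2 a1 * tperm a1 a0 = c^-1 * c ^ t)%g.
    have -> : (c^-1 * c ^ t = t ^ c * t)%g by rewrite !conjgE tpermV !mulgA.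
    by rewrite tpermJ; congr (_ * _)%g; rewrite tpermC; congr tperm; rewrite ?c1; apply: val_inj.
  by rewrite groupM ?groupV // memJ_norm // (subsetP nK) ?inE.
apply: (@irr_3cycle_linear _ _ a2 a1 a0) => //.
by apply/eqP; move: K3; rewrite cfkerEirr inE.
Qed.

(** * Restriction to a point stabiliser and the Jucys-Murphy element *)

Section Restriction.

Variables (n : nat) (d : nat) (rG : mx_representation algC (Sym n.+1) d).

Let rH_fun (s : 'S_n) := rG (lift_perm ord_max ord_max s).

Lemma lift_mx_repr : mx_repr (Sym n) rH_fun.
Proof.
split=> [|s t _ _]; rewrite /rH_fun; first by rewrite lift_perm1 repr_mx1.
by rewrite -repr_mxM ?inE // lift_permM.
Qed.

Definition lift_repr := MxRepresentation lift_mx_repr.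

Lemma cfRepr_lift s : cfRepr lift_repr s = cfRepr rG (lift_perm ord_max ord_max s).
Proof. by rewrite !cfunE !inE. Qed.

Let tau (i : 'I_n) : 'S_n.+1 := tperm (lift ord_max i) ord_max.

(** Conjugation by the stabiliser of [ord_max] permutes the terms of [X], so Schur's lemma makes [X]
    scalar. The identity is the trace of [X *m rG g]. *)
Lemma jucys_murphy_scalar : mx_irreducible lift_repr ->
  exists a : algC, forall g, \sum_i cfRepr rG (tau i * g)%g = a * cfRepr rG g.
Proof.
move=> irr_rH; pose X := \sum_i rG (tau i).
have /is_scalar_mxP[a Xa] : is_scalar_mx X.
  apply: (mx_abs_irr_cent_scalar (groupC irr_rH)).
  apply/centgmxP => s _; rewrite /= /rH_fun mulmx_suml mulmx_sumr.
  rewrite [RHS](reindex_inj (@perm_inj _ s)) /=; apply: eq_bigr => i _.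
  rewrite -!repr_mxM ?inE //; congr (rG _).
  have -> : tau (s i) = (tau i ^ lift_perm ord_max ord_max s)%g.
    by rewrite tpermJ lift_perm_lift lift_perm_id.
  exact: conjgC.
exists a => g; have e h : cfRepr rG h = \tr (rG h) by rewrite cfunE inE.
rewrite e; transitivity (\tr (X *m rG g)).
  by rewrite mulmx_suml raddf_sum /=; apply: eq_bigr => i _; rewrite e repr_mxM ?inE.
by rewrite Xa mul_scalar_mx linearZ.
Qed.

End Restriction.

Lemma sum_irr1_eq0 (gT : finGroupType) (G : {group gT}) (r : seq (Iirr G)) :
  (\sum_(i <- r) 'chi_i 1%g == 0) = (r == [::]).
Proof.
case: r => [|i r]; first by rewrite big_nil eqxx.
rewrite big_cons; apply/negbTE; rewrite gt_eqF // ltr_wpDr ?irr1_gt0 //.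
by apply: sumr_ge0 => j _; apply/ltW/irr1_gt0.
Qed.

Lemma irr_Sym_degree n i : (5 <= n)%N ->
  'chi[Sym n]_i 1%g < n.-1%:R -> 'chi_i \is a linear_char.
Proof.
elim: n i => // n IH i; rewrite leq_eqVlt => /orP[/eqP e|n5].
  by case: e => e; subst n; apply: irr_Sym5_degree.
have {}n5 : (5 <= n)%N by [].
set chi := 'chi_i => dn.
have /irr_reprP[[d rG] /= _ Dchi] := mem_irr i.
have chi1 : chi 1%g = d%:R by rewrite /chi Dchi cfRepr1.
rewrite chi1 ltr_nat /= in dn.
have lt k : (k < 5)%N -> (k < n)%N by move=> /leq_trans; apply.
pose x0 := Ordinal (lt 0%N isT); pose x1 := Ordinal (lt 1%N isT).
pose x2 := Ordinal (lt 2%N isT); pose x3 := Ordinal (lt 3%N isT).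
pose L := lift_perm (@ord_max n) ord_max.
have LD s t : L (s * t)%g = (L s * L t)%g by rewrite lift_permM.
have liftT (x y : 'I_n) : L (tperm x y) = tperm (lift ord_max x) (lift ord_max y).
  apply/permP => z; case: (unliftP ord_max z) => [w|] ->.
    rewrite lift_perm_lift; have [->|wx] := eqVneq w x; first by rewrite !tpermL.
    have [->|wy] := eqVneq w y; first by rewrite !tpermR.
    by rewrite !tpermD // ?(inj_eq lift_inj) eq_sym.
  by rewrite lift_perm_id tpermD // eq_sym neq_lift.
have u3 : uniq [:: lift ord_max x0; lift ord_max x1; lift ord_max x2].
  by rewrite [uniq _](map_inj_uniq (@lift_inj n.+1 ord_max) [:: x0; x1; x2]).
have [r Dr] := char_sum_irr (cfRepr_char (lift_repr rG)).
have Dr1 : d%:R = \sum_(j <- r) 'chi_j 1%g by rewrite -sum_cfunE -Dr cfRepr1.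
(* If the restriction has only linear constituents, a commutator, here a 3-cycle, acts trivially. *)
have [lin|] := boolP (all (fun j => 'chi_j \is a linear_char) r).
  apply: (irr_3cycle_linear u3).
  pose g := [~ tperm x1 x2, tperm x0 x1]%g.
  have Dg : L g = (tperm (lift ord_max x0) (lift ord_max x1) *
                  tperm (lift ord_max x1) (lift ord_max x2))%g.
    by rewrite /g commg_tperm // LD !liftT.
  rewrite -Dg -/chi chi1 /chi Dchi -cfRepr_lift Dr sum_cfunE Dr1.
  apply: eq_big_seq => j /(allP lin) lin_j.
  have /subsetP/(_ g) := lin_char_der1 lin_j; rewrite cfkerEirr inE => h; apply/eqP/h.
  by rewrite mem_commg ?inE.
case/allPn => j rj nlin_j.
have dj : n.-1%:R <= 'chi_j 1%g.
  rewrite real_leNgt ?realn //; first by apply: contra nlin_j; apply: IH.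
  by rewrite ger0_real // char1_ge0 ?irr_char.
have Pr := perm_to_rem rj.
have Dr1' : d%:R = 'chi_j 1%g + \sum_(k <- rem j r) 'chi_k 1%g.
  by rewrite Dr1 (perm_big _ Pr) big_cons.
(* [d < n], while [j] alone has degree at least [n.-1]: no room is left for another constituent. *)
have rem0 : rem j r = [::].
  have /natrP[e De] : \sum_(k <- rem j r) 'chi_k 1%g \in Num.nat.
    by apply: rpred_sum => k _; apply: Cnat_irr1.
  apply/eqP; rewrite -sum_irr1_eq0 De pnatr_eq0.
  have /natrP[f Df] := Cnat_irr1 j; move: Dr1' dj; rewrite De Df ler_nat -natrD => /eqP.
  rewrite eqr_nat; move: dn; lia.
have irrH : mx_irreducible (lift_repr rG).
  have : cfRepr (lift_repr rG) \in irr (Sym n).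
    by rewrite Dr (perm_big _ Pr) rem0 big_seq1 mem_irr.
  case/irr_reprP => rH irr_rH e; apply: mx_rsim_irr irr_rH.
  by apply/cfRepr_rsimP; rewrite e.
have {}dn : d = n.-1.
  by rewrite rem0 big_nil addr0 in Dr1'; move: dn dj; rewrite -Dr1' ler_nat; lia.
have [a Ha] := jucys_murphy_scalar irrH.
rewrite -Dchi -/chi in Ha.
pose M : 'I_n.+1 := ord_max; pose y0 : 'I_n.+1 := lift ord_max x0.
pose y1 : 'I_n.+1 := lift ord_max x1; pose y2 : 'I_n.+1 := lift ord_max x2.
pose y3 : 'I_n.+1 := lift ord_max x3.
have LM x : lift ord_max x != M by rewrite eq_sym neq_lift.
have LL x y : (lift ord_max x == lift M y) = (x == y) by rewrite (inj_eq lift_inj).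
have Nchi : chi \is a character := irr_char i.
have u4 : uniq [:: y0; y1; y2; y3].
  by rewrite [uniq _](map_inj_uniq (@lift_inj n.+1 ord_max) [:: x0; x1; x2; x3]).
have [t Dt] := char_tperm_int Nchi (LM x0).
have [c Dc] := char_3cycle_int Nchi u3.
have [q Dq] := char_22cycle_int Nchi u4.
have T x y : x != y -> chi (tperm x y) = t%:~R.
  by move=> xy; rewrite -Dt; apply: cfun_tperm.
have C x y z : uniq [:: x; y; z] -> chi (tperm x y * tperm y z)%g = c%:~R.
  by move=> u; rewrite -Dc; apply: cfun_3cycle.
have Q x y z w : uniq [:: x; y; z; w] -> chi (tperm x y * tperm z w)%g = q%:~R.
  by move=> u; rewrite -Dq; apply: cfun_22cycle.
(* Trace of the Jucys-Murphy element times 1, a transposition moving [ord_max],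
   and a transposition fixing [ord_max]. *)
have E1 : n%:R * t%:~R = a * d%:R.
  rewrite -chi1 -Ha (eq_bigr (fun=> t%:~R)) ?sumr_const ?card_ord -?[RHS]mulr_natl //.
  by move=> x _; rewrite mulg1 T.
have E2 : d%:R + n.-1%:R * c%:~R = a * t%:~R.
  rewrite -Dt -Ha (bigD1 x0) //= tperm2 chi1; congr (_ + _).
  rewrite (eq_bigr (fun=> c%:~R)).
    by rewrite sumr_const cardC1 card_ord mulr_natl.
  move=> x xx0; rewrite [X in (_ * X)%g]tpermC C //= !inE !negb_or LM LL xx0 /=.
  by rewrite eq_sym LM.
have E3 : 2 * c%:~R + (n - 2)%:R * q%:~R = a * t%:~R.
  have x01 : x0 != x1 by [].
  rewrite -(T y0 y1) ?LL // -Ha (bigD1 x0) //= (bigD1 x1) //= addrA; congr (_ + _).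
    rewrite tpermC C /=; last by rewrite !inE !negb_or eq_sym LM (eq_sym M) LM LL.
    rewrite [X in (X * _)%g]tpermC [X in (_ * X)%g]tpermC C; first by rewrite mulr2n mulrDl mul1r.
    by rewrite /= !inE !negb_or !LL eq_sym !LM (eq_sym M) LM.
  rewrite (eq_bigr (fun=> q%:~R)).
    rewrite sumr_const mulr_natl; congr (_ *+ _).
    have := cardsC [set x0; x1]; rewrite card_ord cards2 x01 => e.
    transitivity #|~: [set x0; x1]|; first by clear -e; lia.
    by apply: eq_card => x; rewrite !inE negb_or.
  move=> x /andP[xx0 xx1]; rewrite Q //= !inE !negb_or !LL LM xx0 xx1.
  by rewrite ![M == _]eq_sym !LM.
(* Elimination of [a], with [d = n.-1]: [F1] comes from [E1] and [E2], and [F2] from [E2] and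
   [E3]. *)
have F1 : d%:Z * (d%:Z * (1 + c)) = n%:Z * (t * t).
  apply: (@intr_inj algC); rewrite !intrM intrD -!pmulrn (mulrDr d%:R) mulr1 {3}dn E2.
  by rewrite [LHS]mulrCA mulrA -E1 mulrA.
have F2 : 2 * c + (n - 2)%:Z * q = d%:Z * (1 + c).
  apply: (@intr_inj algC); rewrite !(intrD, intrM). rewrite (mulrDr d%:~R) mulr1.
  by rewrite [LHS]E3 -E2 dn.
have cd : `|c| <= d%:Z.
  have := char1_ge_norm (tperm y0 y1 * tperm y1 y2)%g Nchi.
  by rewrite Dc chi1 -intr_norm -[d%:R]/((d%:Z)%:~R) ler_int.
have d0 : (0 < d)%N by lia.
have v0 : 0 <= 1 + c.
  rewrite -(pmulr_rge0 _ (_ : 0 < d%:Z)) // -(pmulr_rge0 _ (_ : 0 < d%:Z)) // F1.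
  by rewrite mulr_ge0 // -expr2 sqr_ge0.
(* [F2] says that [n - 2] divides [1 - c]. *)
have [cE|cE] : c = 1 \/ c = d%:Z.
  have : (n%:Z - 2) * (q - (1 + c)) = 1 - c.
    have e1 : (n - 2)%N%:Z = n%:Z - 2 by lia.
    have e2 : d%:Z = n%:Z - 1 by lia.
    by move: F2; rewrite e1 e2; clear; lia.
  have n2 : 0 <= n%:Z - 2 by lia.
  (* Since [-1 <= c <= n - 1], the number [1 - c] lies between [-(n - 2)] and 2, so the quotient is
     0 or -1. *)
  have : q - (1 + c) = 0 \/ q - (1 + c) = -1 \/ 1 <= q - (1 + c) \/ q - (1 + c) <= -2 by lia.
  case=> [->|[->|[h|h]]] e; [left; lia|right; lia| |].
    by have := ler_wpM2l n2 h; rewrite e; move: n5 v0; clear; lia.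
  by have := ler_wpM2l n2 h; rewrite e; move: n5 cd dn; clear; lia.
  (* For [c = 1], [n] divides [2 * d ^ 2] and is coprime to [d = n.-1], so it would divide 2. For
     [c = d] the 3-cycle lies in the kernel. *)
  move: F1; rewrite cE => /(congr1 absz); rewrite !abszM /= => {}F1.
  have : (n %| d ^ 2 * 2)%N by rewrite expnS expn1 -mulnA F1 dvdn_mulr.
  rewrite Gauss_dvdr; first by move/dvdn_leq => /(_ isT); lia.
  by rewrite dn coprimeXr // -{1}(prednK (ltn_trans _ n5)) // coprimeSn.
by apply: (irr_3cycle_linear u3); rewrite -/chi Dc cE chi1.
Qed.

(** * Derangements *)

Definition nfix n (s : 'S_n) := #|[set i | s i == i]|.

(** Double count of pairs of a permutation and a [k]-set of its fixed points. *)
Lemma sum_bin_nfix n k :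
  (\sum_(s : 'S_n) 'C(nfix s, k) = 'C(n, k) * (n - k)`!)%N.
Proof.
transitivity (\sum_(s : 'S_n)
    \sum_(D : {set 'I_n} | (D \subset [set i | s i == i]) && (#|D| == k)) 1)%N.
  by apply: eq_bigr => s _; rewrite -cards_draws sum1_card; apply: eq_card => D; rewrite inE.
rewrite (exchange_big_dep (fun D : {set 'I_n} => #|D| == k)) /=; last first.
  by move=> s D _ /andP[].
transitivity (\sum_(D : {set 'I_n} | #|D| == k) (n - k)`!)%N.
  apply: eq_bigr => D /eqP Dk; rewrite sum1_card.
  have -> : (n - k)%N = #|~: D| by rewrite cardsCs setCK card_ord Dk.
  rewrite -card_perm; apply: eq_card => s; rewrite [LHS]unfold_in Dk eqxx andbT [RHS]unfold_in.
  apply/subsetP/subsetP => Ds i; rewrite !inE.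
    by apply: contra => /Ds; rewrite inE.
  by move=> Di; apply: contraTT Di => /Ds; rewrite inE.
rewrite sum_nat_const; congr (_ * _)%N.
rewrite -[in RHS](card_ord n) -card_draws; apply: eq_card => D; by rewrite inE.
Qed.

Definition derangements n : {set 'S_n} := [set s | nfix s == 0]%N.

Lemma sum_bin_nfix_fact n k : (k <= n)%N ->
  (k`! * \sum_(s : 'S_n) 'C(nfix s, k) = n`!)%N.
Proof. by move=> kn; rewrite sum_bin_nfix mulnCA bin_fact. Qed.

Lemma nfix1 n : nfix (1%g : 'S_n) = n.
Proof. by rewrite -[RHS]card_ord -cardsT; apply: eq_card => i; rewrite !inE perm1 eqxx. Qed.

(** Inclusion-exclusion truncated after the third term, with the negative terms moved across. For
    positive [m] the slack before adding the indicator is ['C(m - 1, 3)], so it is at least 1 once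
    [4 <= m]. *)
Lemma bonferroni3 m : (1 + 'C(m, 2) + (4 <= m) <= (m == 0) + m + 'C(m, 3))%N.
Proof.
case: m => // m; rewrite !binS bin1.
have : (4 <= m.+1 -> 0 < 'C(m, 3))%N by move=> h; rewrite bin_gt0.
case: (4 <= m.+1)%N => /= [/(_ isT)|_]; lia.
Qed.

(** Summing [bonferroni3] gives the bound [n! (1 - 1 + 1/2 - 1/6) = n! / 3]; the identity, with its
    [n >= 4] fixed points, makes it strict. *)
Lemma ltn_fact_derangements n : (4 <= n)%N -> (n`! < 3 * #|derangements n|)%N.
Proof.
move=> n4.
have : (\sum_(s : 'S_n) (1 + 'C(nfix s, 2) + (4 <= nfix s)) <=
   \sum_(s : 'S_n) ((nfix s == 0) + nfix s + 'C(nfix s, 3)))%N.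
  by apply: leq_sum => s _; apply: bonferroni3.
rewrite !big_split /= sum1_card card_Sn.
have -> : (\sum_(s : 'S_n) (nfix s == 0) = #|derangements n|)%N.
  by rewrite -sum1_card [RHS]big_mkcond /=; apply: eq_bigr => s _; rewrite inE; case: eqP.
have : (0 < \sum_(s : 'S_n) (4 <= nfix s))%N.
  rewrite (bigD1 1%g) //= addn_gt0; apply/orP; left.
  by rewrite nfix1 n4.
have := @sum_bin_nfix_fact n 1 (ltnW (ltnW (ltnW n4))).
have := @sum_bin_nfix_fact n 2 (ltnW (ltnW n4)); have := @sum_bin_nfix_fact n 3 (ltnW n4).
have -> : (\sum_(s : 'S_n) 'C(nfix s, 1) = \sum_(s : 'S_n) nfix s)%N.
  by apply: eq_bigr => s _; rewrite bin1.
move: (\sum_(s : 'S_n) 'C(nfix s, 3))%N (\sum_(s : 'S_n) 'C(nfix s, 2))%N => a b.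
move: (\sum_(s : 'S_n) nfix s)%N (\sum_(s : 'S_n) (4 <= nfix s))%N => c e.
rewrite !factS fact0; move: n`! #|_| => x y; lia.
Qed.

Lemma nfixJ n (s t : 'S_n) : nfix (s ^ t)%g = nfix s.
Proof.
rewrite /nfix -(card_imset [set i | s i == i] (@perm_inj _ t)); apply: eq_card => i.
apply/idP/imsetP => [|[j]]; rewrite inE.
  by rewrite -[i](permKV t) permJ (inj_eq (@perm_inj _ t)) => h; exists (t^-1 i)%g; rewrite ?inE.
by move=> /eqP sj ->; rewrite inE permJ sj.
Qed.

Lemma nfixV n (s : 'S_n) : nfix s^-1%g = nfix s.
Proof.
by apply: eq_card => i; rewrite !inE -{1}(inj_eq (@perm_inj _ s)) permKV eq_sym.
Qed.

Lemma derangements_normal n : (derangements n <| Sym n)%g.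
Proof.
rewrite /normal subsetT; apply/subsetP => t _; rewrite inE; apply/subsetP => s.
by rewrite mem_conjg !inE nfixJ.
Qed.

(** * The standard and the sign characters *)

Section Standard.

Variable n : nat.

Lemma perm_mx_repr : mx_repr (Sym n) (@perm_mx algC n).
Proof. by split=> [|s t _ _]; rewrite ?perm_mx1 ?perm_mxM. Qed.

Definition perm_char : 'CF(Sym n) := cfRepr (MxRepresentation perm_mx_repr).

Lemma perm_charE s : perm_char s = (nfix s)%:R.
Proof.
rewrite cfunE inE mulr1n /= /mxtrace /nfix -sum1_card natr_sum [RHS]big_mkcond /=.
by apply: eq_bigr => i _; rewrite !mxE inE eq_sym; case: eqP.
Qed.

Hypothesis n2 : (2 <= n)%N.

Let cG : #|Sym n|%:R = n`!%:R :> algC.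
Proof. by rewrite cardsT card_Sn. Qed.

Let N0 : n`!%:R != 0 :> algC.
Proof. by rewrite pnatr_eq0 -lt0n fact_gt0. Qed.

(** The first two moments of [nfix] are [n!] and [2 n!], so [perm_char - 1] has norm 1. It is then
    an irreducible character up to sign, and its positive value at the identity fixes the sign. *)
Lemma Sym_standard_irr : exists i : Iirr (Sym n), forall s, 'chi_i s = (nfix s)%:R - 1.
Proof.
have s1 : \sum_(s : 'S_n) (nfix s)%:R = n`!%:R :> algC.
  rewrite -natr_sum -(@sum_bin_nfix_fact n 1) 1?ltnW // mul1n.
  by congr (_%:R); apply: eq_bigr => s _; rewrite bin1.
have s2 : \sum_(s : 'S_n) (nfix s)%:R ^+ 2 = 2 * n`!%:R :> algC.
  rewrite mulr_natl mulr2n -{1}s1 -(@sum_bin_nfix_fact n 2) // natrM !natr_sum mulr_sumr.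
  rewrite -big_split /=; apply: eq_bigr => s _; rewrite -natrX -natrM -natrD; congr (_%:R).
  have := bin_ffact (nfix s) 2; rewrite ffactnS ffactn1; move: (nfix s) => m.
  by case: m => // m; rewrite /= mulnC !factS fact0 !muln1; nia.
have vE s : (perm_char - 1) s = (nfix s)%:R - 1.
  by rewrite [LHS]cfunE [X in _ + X]cfunE perm_charE cfun1E inE.
have n11 : '[perm_char - 1] = 1.
  rewrite cfdotE cG.
  rewrite (eq_bigr (fun s => (nfix s)%:R ^+ 2 - 2 * (nfix s)%:R + 1)); last first.
    by move=> s _; rewrite vE rmorphB /= rmorph1 rmorph_nat; ring.
  rewrite (eq_bigl predT) => [|s]; last by rewrite inE.
  rewrite !big_split /= s2 sumrN -mulr_sumr s1 sumr_const card_Sn.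
  by rewrite subrr add0r mulVf.
have Z : perm_char - 1 \in 'Z[irr (Sym n)]%g.
  by rewrite rpredB ?char_vchar ?cfRepr_char ?rpred1.
have e1 : (perm_char - 1) 1%g = n%:R - 1.
  by rewrite vE nfix1.
case/vchar_norm1P: Z => // b [i Di]; exists i => s.
suff b0 : b = false.
  by rewrite -vE Di b0 expr0 scale1r.
case: b Di => // /(congr1 (fun phi : 'CF(_) => phi 1%g)); rewrite e1 !cfunE expr1 mulN1r => e.
have := irr1_gt0 i; rewrite -[_ 1%g]opprK -e oppr_gt0 subr_lt0 ltrn1.
by case: (n) n2.
Qed.

End Standard.

(** Two block-triangular factorisations of one matrix (Sylvester's identity). *)
Lemma det_sub1_rank1 (R : comPzRingType) n (u : 'cV[R]_n) (v : 'rV[R]_n) :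
  \det (1%:M - u *m v) = \det (1%:M - v *m u).
Proof.
transitivity (\det (block_mx (1%:M : 'M_1) v u 1%:M)).
  have -> : block_mx (1%:M : 'M_1) v u 1%:M =
      block_mx 1%:M 0 u 1%:M *m block_mx 1%:M v 0 (1%:M - u *m v).
    by rewrite mulmx_block !mul1mx !mulmx1 !mul0mx !addr0 addrC subrK.
  by rewrite det_mulmx det_lblock det_ublock !det1 !mul1r.
have -> : block_mx (1%:M : 'M_1) v u 1%:M =
    block_mx 1%:M v 0 1%:M *m block_mx (1%:M - v *m u) 0 u 1%:M.
  by rewrite mulmx_block !mul1mx !mulmx1 !mul0mx !add0r subrK.
by rewrite det_mulmx det_lblock det_ublock !det1 !mul1r mulr1.
Qed.

(** The sum is the Leibniz expansion of the determinant of the all-ones matrix minus the identity,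
    whose diagonal zeros kill every permutation with a fixed point. *)
Lemma sum_sign_derangements n :
  `| \sum_(s in derangements n) (-1) ^+ s | = `|n%:R - 1| :> algC.
Proof.
pose u : 'cV[algC]_n := const_mx 1; pose v : 'rV[algC]_n := const_mx 1.
have -> : \sum_(s in derangements n) (-1) ^+ s = \det (u *m v - 1%:M).
  rewrite big_mkcond /=; apply: eq_bigr => s _.
  have e i : (u *m v - 1%:M) i (s i) = (s i != i)%:R.
    rewrite !mxE big_ord1 !mxE mulr1 eq_sym; case: eqP => _; rewrite ?subrr ?subr0 //.
  rewrite (eq_bigr _ (fun i _ => e i)) inE; case: ifP => [s0|s0].
    rewrite big1 ?mulr1 // => i _; rewrite (_ : _ != _) //.
    by apply: contraTneq s0 => si; rewrite -lt0n; apply/card_gt0P; exists i; rewrite inE si.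
  move/negbT: s0; rewrite -lt0n => /card_gt0P[i]; rewrite inE => /eqP si.
  by rewrite (bigD1 i) //= si eqxx mul0r mulr0.
rewrite -opprB -scaleN1r detZ normrM normrX normrN1 expr1n mul1r det_sub1_rank1.
rewrite det_mx11 !mxE -[in RHS]normrN opprB; congr `|_ - _|.
by rewrite (eq_bigr (fun=> 1)) ?sumr_const ?card_ord // => i _; rewrite !mxE mulr1.
Qed.

Lemma lin_char_Sym n (i : Iirr (Sym n)) : 'chi_i \is a linear_char -> i != 0 ->
  forall s : 'S_n, 'chi_i s = (-1) ^+ s.
Proof.
move=> lin i0.
have [/existsP[x /existsP[y /andP[xy ne1]]]|] := boolP [exists x : 'I_n, exists y : 'I_n,
   (x != y) && ('chi_i (tperm x y) != 1)]; last first.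
  move=> h; case/eqP: i0; apply: irr_inj; rewrite irr0; apply/cfunP => s.
  rewrite cfun1E inE; have [ts -> _] := prod_tpermP s.
  rewrite lin_char_prod // => [|? _]; last by rewrite inE.
  apply: big1_seq => -[x y] /=; have [->|xy] := eqVneq x y => _.
    by rewrite tperm1 lin_char1.
  apply/eqP; apply: contraNT h => ne1; apply/existsP; exists x; apply/existsP; exists y.
  by rewrite xy.
have t x' y' : x' != y' -> 'chi_i (tperm x' y') = -1.
  move=> xy'; rewrite (cfun_tperm _ xy' xy).
  have : 'chi_i (tperm x y) ^+ 2 == 1.
    by rewrite expr2 -lin_charM ?inE // tperm2 lin_char1.
  by rewrite sqrf_eq1 (negbTE ne1) => /eqP.
move=> s; have [ts -> /allP d] := prod_tpermP s.
rewrite lin_char_prod // => [|? _]; last by rewrite inE.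
elim: ts d => [|[a b] ts IH] d; first by rewrite !big_nil odd_perm1.
rewrite !big_cons IH => [|z zts]; last by apply: d; rewrite inE zts orbT.
have ab : a != b by apply: (d (a, b)); rewrite mem_head.
by rewrite odd_permM odd_tperm t ab //= signrN mulN1r.
Qed.

(** * The spectrum of the derangement graph *)

Section Derangement.

Variable n : nat.
Implicit Types i : Iirr (Sym n).

Definition derangement_cfun : 'CF(Sym n) := '1_(derangements n).
Local Notation delta := derangement_cfun.
Local Notation p := (#|derangements n|%:R / n`!%:R : algC).

Lemma derangement_cfunE s : delta s = (s \in derangements n)%:R.
Proof. by rewrite cfuniE ?derangements_normal. Qed.

Let cG : #|Sym n|%:R = n`!%:R :> algC.
Proof. by rewrite cardsT card_Sn. Qed.

Let N0 : n`!%:R != 0 :> algC.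
Proof. by rewrite pnatr_eq0 -lt0n fact_gt0. Qed.

Lemma cfdot_derangement (phi : 'CF(Sym n)) :
  '[delta, phi] = n`!%:R^-1 * \sum_(s in derangements n) (phi s)^*.
Proof.
rewrite cfdotE cG; congr (_ * _); rewrite [LHS]big_mkcond [RHS]big_mkcond /=.
apply: eq_bigr => s _; rewrite inE derangement_cfunE.
by case: ifP; rewrite ?mul1r ?mul0r.
Qed.

Lemma cfdot_derangement_real i : '[delta, 'chi_i] \is Num.real.
Proof.
apply/CrealP; rewrite cfdot_derangement rmorphM /= fmorphV rmorph_nat; congr (_ * _).
rewrite rmorph_sum /= (reindex_inj invg_inj) /=; apply: eq_big => s.
  by rewrite !inE nfixV.
by move=> _; rewrite irr_inv conjCK.
Qed.

Lemma cfdot_derangement1 : '[delta, 'chi_0] = p.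
Proof.
rewrite irr0 cfdot_derangement mulrC; congr (_ / _).
rewrite (eq_bigr (fun=> 1)) ?sumr_const // => s _.
by rewrite cfun1E inE rmorph1.
Qed.

Lemma cfdot_derangement_standard i : (forall s, 'chi_i s = (nfix s)%:R - 1) ->
  '[delta, 'chi_i] = - p.
Proof.
move=> chiE; rewrite cfdot_derangement mulrC -mulNr; congr (_ / _).
rewrite -[RHS]mulNrn -sumr_const; apply: eq_bigr => s; rewrite inE => /eqP s0.
by rewrite chiE s0 sub0r rmorphN rmorph1.
Qed.

(** The comparison of the normalised eigenvalue with [p / n.-1], cleared of denominators. For the
    sign it follows from [3 (n - 1)^2 <= n!]. In degree at least [n.-1] a coefficient below [p]
    suffices, and Parseval gives it since [3 p > 1]. *)
Lemma derangement_spectrum i1 i : (5 <= n)%N ->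
    (forall s, 'chi_i1 s = (nfix s)%:R - 1) -> i != 0 -> i != i1 ->
  `|'[delta, 'chi_i]| * n.-1%:R < p * 'chi_i 1%g.
Proof.
move=> n5 chi1E i0 ii1.
have d3 := ltn_fact_derangements (ltnW n5); set d := #|derangements n| in d3 *.
have Ngt0 : 0 < n`!%:R :> algC by rewrite ltr0n fact_gt0.
have [lin|nlin] := boolP ('chi_i \is a linear_char).
  rewrite lin_char1 // mulr1 cfdot_derangement normrM.
  rewrite (eq_bigr (fun s : 'S_n => (-1) ^+ s)); last first.
    by move=> s _; rewrite lin_char_Sym // rmorph_sign.
  rewrite sum_sign_derangements normfV normr_nat -mulrA mulrC.
  rewrite ltr_pM2r ?invr_gt0 //.
  have -> : n%:R - 1 = n.-1%:R :> algC by case: (n) n5 => // m _; rewrite -natr1 addrK.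
  rewrite normr_nat -natrM ltr_nat.
  suff : (3 * (n.-1 * n.-1) <= n`!)%N by move: d3; clear; nia.
  case: (n) n5 => // -[|m] // m5; rewrite !factS /=.
  have : (m.+1 <= m.+1 * m`!)%N by rewrite leq_pmulr // fact_gt0.
  have : (0 < m`!)%N by apply: fact_gt0.
  case: m m5 => // m m5; rewrite factS; have := fact_gt0 m; move: m`! => f; nia.
have n1 : n.-1%:R <= 'chi_i 1%g.
  rewrite real_leNgt ?realn //; first by apply: contra nlin; apply: irr_Sym_degree.
  by rewrite ger0_real // char1_ge0 ?irr_char.
have p0 : 0 < p by rewrite divr_gt0 // ltr0n; move: d3; lia.
have i10 : i1 != 0.
  apply/eqP => e; have := chi1E 1%g; rewrite e irr0 cfun1E inE nfix1 => n2.
  have /eqP : n%:R = 2%:R :> algC by rewrite -[LHS](subrK 1) -n2.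
  by rewrite eqr_nat; move: n5; lia.
suff lt : `|'[delta, 'chi_i]| < p.
  apply: lt_le_trans (ler_wpM2l (ltW p0) n1).
  by rewrite ltr_pM2r // ltr0n; move: n5; lia.
rewrite -(@ltr_pXn2r _ 2) ?nnegrE ?normr_ge0 ?(ltW p0) //.
have : '[delta] = p.
  rewrite cfdotE cG mulrC; congr (_ / _); rewrite -sumr_const [LHS]big_mkcond [RHS]big_mkcond /=.
  apply: eq_bigr => s _; rewrite inE derangement_cfunE.
  by case: (_ \in _); rewrite ?mul0r // mul1r rmorph1.
rewrite cfdot_sum_irr (bigD1 0) //= (bigD1 i1) //= (bigD1 i) /=; last by rewrite i0.
set rest := \sum_(_ < _ | _) _; have rest0 : 0 <= rest.
  by apply: sumr_ge0 => j _; apply: mul_conjC_ge0.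
rewrite -!normCK cfdot_derangement1 (cfdot_derangement_standard chi1E) normrN.
rewrite ger0_norm ?(ltW p0) // => e.
have {e}-> : `|'[delta, 'chi_i]| ^+ 2 = p - p ^+ 2 - p ^+ 2 - rest by rewrite -{1}e; ring.
rewrite -subr_gt0.
have -> : p ^+ 2 - (p - p ^+ 2 - p ^+ 2 - rest) = p * (3 * p - 1) + rest by ring.
rewrite ltr_wpDr // mulr_gt0 // subr_gt0 mulrA ltr_pdivlMr // mul1r -natrM ltr_nat.
exact: d3.
Qed.

End Derangement.

(** * Isotypic decomposition of functions on a finite group *)

Section Isotypic.

Variable gT : finGroupType.
Local Notation G := [set: gT]%G.
Local Notation N := (#|gT|%:R : algC).
Implicit Types (h : gT -> algC) (i : Iirr G) (x y : gT).

(* The orthogonal projection of [h] onto the [i]-isotypic part of the regular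
   representation, and its squared norm. *)
Definition isotypic i h y := 'chi_i 1%g / N * \sum_x h x * 'chi_i (x^-1 * y)%g.

Definition isotypic_norm i h :=
  'chi_i 1%g / N * \sum_x \sum_y h x * h y * 'chi_i (x^-1 * y)%g.

Let N0 : N != 0.
Proof. by rewrite pnatr_eq0 -lt0n; apply/card_gt0P; exists 1%g. Qed.

Let NG : #|G|%:R = N.
Proof. by rewrite cardsT. Qed.

Lemma irr_convolution i x y :
  \sum_z 'chi_i (x^-1 * z)%g * ('chi_i (y^-1 * z)%g)^* = N / 'chi_i 1%g * 'chi_i (x^-1 * y)%g.
Proof.
have := generalized_orthogonality_relation (x^-1 * y)%g i i.
rewrite eqxx mul1r NG => e.
have -> : N / 'chi_i 1%g * 'chi_i (x^-1 * y)%g = N * ('chi_i (x^-1 * y)%g / 'chi_i 1%g).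
  by rewrite -mulrA [_^-1 * _]mulrC.
rewrite -e mulVKf //.
rewrite (reindex_inj (mulgI y)) /= [RHS](eq_bigl predT) => [|z]; last by rewrite inE.
apply: eq_bigr => z _; rewrite mulKg irr_inv; congr (_ * _).
by rewrite -[RHS](cfunJ _ _ (in_setT z)) conjgE !mulgA mulVg mul1g.
Qed.

(** By [irr_convolution] the projection is idempotent and self-adjoint, so its quadratic form is a
    sum of squares. *)
Lemma isotypic_normE i h : (forall x, h x \is Num.real) ->
  isotypic_norm i h = \sum_y `|isotypic i h y| ^+ 2.
Proof.
move=> hR; have c0 := irr1_neq0 i; pose c := 'chi_i 1%g / N.
have cR : c^* = c.
  by rewrite /c rmorphM /= fmorphV rmorph_nat; have /natrP[m ->] := Cnat_irr1 i; rewrite rmorph_nat.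
transitivity (\sum_z \sum_x \sum_y
   c ^+ 2 * (h x * h y) * ('chi_i (x^-1 * z)%g * ('chi_i (y^-1 * z)%g)^*)).
  rewrite exchange_big /= /isotypic_norm mulr_sumr; apply: eq_bigr => x _.
  rewrite exchange_big /= mulr_sumr; apply: eq_bigr => y _.
  rewrite -mulr_sumr irr_convolution /c; field; exact/andP.
apply: eq_bigr => z _; rewrite normCK /isotypic -/c rmorphM /= cR rmorph_sum.
rewrite mulrACA -expr2 mulr_suml mulr_sumr; apply: eq_bigr => x _.
rewrite mulr_sumr mulr_sumr; apply: eq_bigr => y _.
by rewrite rmorphM /= (CrealP (hR y)); ring.
Qed.

Lemma isotypic_norm_ge0 i h : (forall x, h x \is Num.real) -> 0 <= isotypic_norm i h.
Proof. by move=> hR; rewrite isotypic_normE // sumr_ge0 // => y _; rewrite exprn_ge0. Qed.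

Lemma isotypic_norm_eq0 i h : (forall x, h x \is Num.real) ->
  isotypic_norm i h = 0 -> forall y, isotypic i h y = 0.
Proof.
move=> hR; rewrite isotypic_normE // => /eqP.
rewrite psumr_eq0 => [/allP h0 y|y _]; last by rewrite exprn_ge0.
by have := h0 y (mem_index_enum y); rewrite /= sqrf_eq0 normr_eq0 => /eqP.
Qed.

Lemma sum_isotypic h y : \sum_i isotypic i h y = h y.
Proof.
transitivity (N^-1 * \sum_x h x * (cfReg G (x^-1 * y)%g)).
  under eq_bigr do rewrite /isotypic mulr_sumr.
  rewrite exchange_big /= mulr_sumr; apply: eq_bigr => x _.
  rewrite cfReg_sum sum_cfunE !mulr_sumr; apply: eq_bigr => i _; rewrite cfunE; ring.
rewrite (bigD1 y) //= cfRegE mulVg eqxx mulr1n NG big1 ?addr0 => [|x xy].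
  by rewrite mulrC mulfK.
by rewrite cfRegE -eq_mulVg1 (negbTE xy) mulr0n mulr0.
Qed.

Lemma isotypic_norm_sum i h : isotypic_norm i h = \sum_y h y * isotypic i h y.
Proof.
rewrite /isotypic_norm exchange_big /= mulr_sumr; apply: eq_bigr => y _.
rewrite /isotypic !mulr_sumr; apply: eq_bigr => x _; ring.
Qed.

Lemma sum_isotypic_norm h : \sum_i isotypic_norm i h = \sum_y h y ^+ 2.
Proof.
rewrite (eq_bigr _ (fun i _ => isotypic_norm_sum i h)) exchange_big /=.
by apply: eq_bigr => y _; rewrite -mulr_sumr sum_isotypic.
Qed.

(** Convolution by a class function is diagonal: it acts on the [i]-isotypic part as the scalar [N *
    '[phi, 'chi_i] / 'chi_i 1%g]. *)
Lemma cfun_form (phi : 'CF(G)) h :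
  \sum_x \sum_y h x * h y * phi (x^-1 * y)%g =
  N * \sum_i '[phi, 'chi_i] / 'chi_i 1%g * isotypic_norm i h.
Proof.
transitivity (\sum_i \sum_x \sum_y h x * h y * ('[phi, 'chi_i] * 'chi_i (x^-1 * y)%g)).
  rewrite [RHS]exchange_big /=; apply: eq_bigr => x _; rewrite [RHS]exchange_big /=.
  apply: eq_bigr => y _; rewrite {1}[phi]cfun_sum_cfdot sum_cfunE mulr_sumr.
  by apply: eq_bigr => i _; rewrite cfunE.
rewrite mulr_sumr; apply: eq_bigr => i _; rewrite /isotypic_norm !mulr_sumr.
apply: eq_bigr => x _; rewrite !mulr_sumr; apply: eq_bigr => y _.
by field; rewrite N0 irr1_neq0.
Qed.

Lemma isotypic_norm0 h : isotypic_norm 0 h = (\sum_x h x) ^+ 2 / N.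
Proof.
rewrite /isotypic_norm irr0 cfun11 mul1r mulrC; congr (_ / _).
rewrite expr2 mulr_suml; apply: eq_bigr => x _; rewrite mulr_sumr.
by apply: eq_bigr => y _; rewrite cfun1E inE mulr1.
Qed.

End Isotypic.

(** * The extremal case *)

Lemma nfix_mulVg n (s t : 'S_n) : nfix (s^-1 * t)%g = #|[set i | s i == t i]|.
Proof.
rewrite /nfix -[RHS](card_imset _ (@perm_inj _ s)); apply: eq_card => i.
apply/idP/imsetP => [|[j]]; rewrite !inE permM.
  by move=> /eqP e; exists (s^-1 i)%g; rewrite ?inE ?permKV ?e.
by move=> /eqP e ->; rewrite permK e.
Qed.

Lemma sum_nfix_mulVg n (A : {set 'S_n}) (t : 'S_n) :
  (\sum_(s in A) nfix (s^-1 * t)%g = \sum_i #|[set s in A | s i == t i]|)%N.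
Proof.
under eq_bigr do rewrite nfix_mulVg -sum1_card big_mkcond /=.
rewrite exchange_big /=; apply: eq_bigr => i _.
rewrite -sum1_card big_mkcond [RHS]big_mkcond /=; apply: eq_bigr => s _.
by rewrite !inE; case: (s \in A).
Qed.

(** Polarisation: [u] and [v] turn the bilinear form in the two indicators into a difference of
    quadratic forms. The final identity expands the indicator of [A] into its trivial and standard
    parts. *)
Lemma cross_extremal n (A B : {set 'S_n}) : (5 <= n)%N -> cross_intersecting A B ->
    (#|A| * #|B| = n.-1`! ^ 2)%N ->
  [/\ A = B, #|A| = n.-1`! & forall t : 'S_n,
      n`!%:R * (t \in A)%:R = n.-1`!%:R +
        n.-1%:R * ((\sum_(s in A) nfix (s^-1 * t)%g)%:R - n.-1`!%:R) :> algC].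
Proof.
move=> n5 AB cAB.
pose f (s : 'S_n) : algC := (s \in A)%:R; pose g (s : 'S_n) : algC := (s \in B)%:R.
pose al : algC := #|A|%:R; pose be : algC := #|B|%:R.
pose K : algC := n.-1`!%:R; pose m : algC := n.-1%:R; pose N : algC := n`!%:R.
have n0 : (0 < n)%N by apply: leq_trans n5.
have NE : N = (m + 1) * K.
  by rewrite /N /m natr1 prednK // -natrM -[in RHS](prednK n0) -factS prednK.
have K0 : 0 < K by rewrite ltr0n fact_gt0.
have m0 : 0 < m by rewrite ltr0n; move: n5; lia.
have N0 : 0 < N by rewrite ltr0n fact_gt0.
have albe : al * be = K ^+ 2 by rewrite -natrM cAB natrX.
have al0 : 0 < al.
  rewrite ltr0n lt0n; apply/eqP => A0; move/eqP: cAB.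
  by rewrite A0 mul0n eq_sym expn_eq0 andbT -leqn0 leqNgt fact_gt0.
(* This weight makes the inequality between the arithmetic and geometric means,
   hidden in the comparison of [u] and [v], tight. *)
pose x := K / al.
pose u s := x * f s + g s; pose v s := x * f s - g s.
have fR s : f s \is Num.real by rewrite /f realn.
have gR s : g s \is Num.real by rewrite /g realn.
have xR : x \is Num.real by rewrite ger0_real // divr_ge0 ?ltW.
have uR s : u s \is Num.real by rewrite realD // realM.
have vR s : v s \is Num.real by rewrite realB // realM.
have sumf : \sum_s f s = al.
  rewrite /al -sum1_card natr_sum [RHS]big_mkcond.
  by apply: eq_bigr => s _; rewrite /f; case: (s \in A).
have sumg : \sum_s g s = be.
  rewrite /be -sum1_card natr_sum [RHS]big_mkcond.
  by apply: eq_bigr => s _; rewrite /g; case: (s \in B).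
have ff s : f s ^+ 2 = f s by rewrite /f; case: (s \in A); rewrite ?expr1n ?expr0n.
have gg s : g s ^+ 2 = g s by rewrite /g; case: (s \in B); rewrite ?expr1n ?expr0n.
have xal : x * al = K by rewrite mulfVK // gt_eqF.
have sumu : \sum_s u s = K + be by rewrite big_split /= -mulr_sumr sumf sumg xal.
have sumv : \sum_s v s = K - be by rewrite big_split /= sumrN -mulr_sumr sumf sumg xal.
have sq : \sum_s u s ^+ 2 + \sum_s v s ^+ 2 = 4 * be.
  rewrite -big_split /= (eq_bigr (fun s => 2 * x ^+ 2 * f s + 2 * g s)); last first.
    by move=> s _; rewrite -[in RHS]ff -[in RHS]gg /u /v; ring.
  rewrite big_split /= -!mulr_sumr sumf sumg.
  have -> : 2 * x ^+ 2 * al = 2 * (x * (x * al)) by ring.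
  rewrite xal /x mulrAC -expr2 -albe mulrAC divff ?gt_eqF //; ring.
pose delta := derangement_cfun n.
have [i1 chi1E] := @Sym_standard_irr n (leq_trans (isT : (2 <= 5)%N) n5).
pose p : algC := #|derangements n|%:R / n`!%:R.
have p0 : 0 < p.
  by rewrite divr_gt0 // ltr0n; have := ltn_fact_derangements (ltnW n5); lia.
have NE' : #|{perm 'I_n}|%:R = N :> algC by rewrite card_Sn.
pose mu i := '[delta, 'chi_i] / 'chi_i 1%g.
pose Q := @isotypic_norm {perm 'I_n}.
have chi_pos i := irr1_gt0 (G := Sym n) i.
(* The cross-intersection hypothesis: the mixed products [f s * g t] and [g s * f t] vanish whenever
   [s^-1 * t] is a derangement. *)
have zero : \sum_i mu i * (Q i u - Q i v) = 0.
  apply: (mulfI (lt0r_neq0 N0)); rewrite mulr0.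
  under eq_bigr do rewrite mulrBr.
  rewrite sumrB mulrBr -NE' -!cfun_form -sumrB big1 // => s _.
  rewrite -sumrB big1 // => t _; rewrite -mulrBl derangement_cfunE.
  have -> : u s * u t - v s * v t = 2 * x * (f s * g t + g s * f t) by rewrite /u /v; ring.
  have [D|] := boolP (_ \in _); last by rewrite mulr0.
  have noAB (s' t' : 'S_n) : s' \in A -> t' \in B -> [exists i, s' i == t' i].
    by move=> sA tB; have [i e] := AB _ _ sA tB; apply/existsP; exists i; rewrite e.
  have nost : ~~ [exists i, s i == t i].
    move: D; rewrite inE nfix_mulVg cards_eq0 => /eqP/setP D.
    by apply/existsP => -[i e]; have := D i; rewrite !inE e.
  have fg : f s * g t = 0.
    rewrite /f /g -natrM mulnb; case: andP => // -[sA tB].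
    by rewrite noAB in nost.
  have gf : g s * f t = 0.
    rewrite /f /g -natrM mulnb; case: andP => // -[sB tA]; case/negP: nost.
    by have /existsP[i e] := noAB _ _ tA sB; apply/existsP; exists i; rewrite eq_sym.
  by rewrite fg gf addr0 mulr0 mul0r.
have muR i : mu i \is Num.real.
  by rewrite rpredM ?cfdot_derangement_real // rpredV ger0_real // ltW.
pose c := p / m.
have mu0 : mu 0 = p by rewrite /mu cfdot_derangement1 irr0 cfun11 divr1.
have mu1 : mu i1 = - c.
  rewrite /mu (cfdot_derangement_standard chi1E) chi1E nfix1 mulNr.
  by congr (- (_ / _)); rewrite /m -[in LHS](prednK n0) -natr1 addrK.
have mu_lt i : i != 0 -> i != i1 -> - c < mu i < c.
  move=> i0 ii1; rewrite -real_ltr_norml //.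
  rewrite normrM normfV (ger0_norm (ltW (chi_pos i))) ltr_pdivrMr // mulrAC.
  by rewrite ltr_pdivlMr // (derangement_spectrum n5 chi1E).
have c0 : 0 < c by rewrite divr_gt0.
have low i : i != 0 -> 0 <= c + mu i.
  move=> i0; have [->|ii1] := eqVneq i i1; first by rewrite mu1 subrr.
  by have /andP[+ _] := mu_lt i i0 ii1; rewrite -subr_gt0 opprK addrC => /ltW.
have high i : i != 0 -> 0 < c - mu i.
  move=> i0; have [->|ii1] := eqVneq i i1; first by rewrite mu1 opprK addr_gt0.
  by have /andP[_] := mu_lt i i0 ii1; rewrite -subr_gt0.
have Qu0 i : 0 <= Q i u := isotypic_norm_ge0 i uR.
have Qv0 i : 0 <= Q i v := isotypic_norm_ge0 i vR.
pose T i := (c + mu i) * Q i u + (c - mu i) * Q i v.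
have T0 i : i != 0 -> 0 <= T i.
  by move=> i0; rewrite addr_ge0 // mulr_ge0 ?low // ltW // high.
have Q0u : Q 0 u = (K + be) ^+ 2 / N by rewrite /Q isotypic_norm0 sumu NE'.
have Q0v : Q 0 v = (K - be) ^+ 2 / N by rewrite /Q isotypic_norm0 sumv NE'.
(* Over all [i] the [mu] part of [T] cancels by [zero], leaving [4 c be]; subtracting the explicit
   [T 0] leaves a nonpositive multiple of a square, while each remaining [T i] is nonnegative. *)
have sumT : \sum_(i | i != 0) T i = - (2 * p / (m * N)) * (K - be) ^+ 2.
  have all : \sum_i T i = c * (4 * be).
    transitivity (c * (\sum_i Q i u + \sum_i Q i v) + \sum_i mu i * (Q i u - Q i v)).
      rewrite -[X in c * X]big_split /= mulr_sumr -big_split /=.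
      by apply: eq_bigr => i _; rewrite /T; ring.
    by rewrite zero addr0 /Q !sum_isotypic_norm sq.
  have := all; rewrite (bigD1 0) //= => /(canRL (addKr _)) ->.
  rewrite /T mu0 Q0u Q0v /c NE; field.
  by rewrite !gt_eqF // addr_gt0.
have sT : 0 <= \sum_(i | i != 0) T i by apply: sumr_ge0.
have KR : K - be \is Num.real by rewrite rpredB ?realn.
have beK : be = K.
  apply/eqP; rewrite eq_sym -subr_eq0 -sqrf_eq0 eq_le; apply/andP; split.
    move: sT; rewrite sumT mulNr oppr_ge0 pmulr_rle0 //.
    by rewrite divr_gt0 // mulr_gt0 // ltr0n.
  by rewrite -real_normK // exprn_ge0.
have alK : al = K.
  by apply: (mulIf (lt0r_neq0 K0)); rewrite -expr2 -{1}beK.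
have x1 : x = 1 by rewrite /x alK divff ?gt_eqF.
have Tz i : i != 0 -> T i = 0.
  have /eqP : \sum_(i | i != 0) T i = 0 by rewrite sumT beK subrr expr0n mulr0.
  rewrite psumr_eq0 // => /allP h i0; apply/eqP.
  by have := h i (mem_index_enum i); rewrite i0.
(* [c - mu i] is positive for every [i != 0], so [v] vanishes and [f = g]; [c + mu i] is zero only
   at [i1], so [u] keeps just its trivial and standard parts. *)
have Qv i : Q i v = 0.
  have [->|i0] := eqVneq i 0; first by rewrite Q0v beK subrr expr0n mul0r.
  have /eqP := Tz i i0.
  rewrite paddr_eq0; [|by rewrite mulr_ge0 ?low|by rewrite mulr_ge0 // ltW ?high].
  by case/andP => _; rewrite mulf_eq0 (gt_eqF (high _ i0)) => /eqP.
have Qu i : i != 0 -> i != i1 -> Q i u = 0.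
  move=> i0 ii1; have /eqP := Tz i i0; rewrite /T Qv mulr0 addr0 mulf_eq0 => /orP[|/eqP//].
  by have /andP[+ _] := mu_lt i i0 ii1; rewrite -subr_gt0 opprK addrC => /gt_eqF->.
have fg s : f s = g s.
  have : \sum_y v y ^+ 2 = 0 by rewrite -sum_isotypic_norm big1 // => i _; apply: Qv.
  move/eqP; rewrite psumr_eq0 => [/allP/(_ s (mem_index_enum s))|y _].
    by rewrite /= sqrf_eq0 /v x1 mul1r subr_eq0 => /eqP.
  by rewrite -real_normK // exprn_ge0.
have eAB : A = B.
  apply/setP => s; have /eqP := fg s; rewrite /f /g eqr_nat.
  by case: (s \in A); case: (s \in B).
split=> //; first by apply/eqP; move/eqP: alK; rewrite eqr_nat.
move=> t.
have uE s : u s = 2 * f s by rewrite /u x1 mul1r -fg; ring.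
have i10 : i1 != 0.
  apply/eqP => e; have : 0 < - c by rewrite -mu1 e mu0.
  by rewrite oppr_gt0 lt_gtF.
have : u t = isotypic 0 u t + isotypic i1 u t.
  rewrite -[LHS]sum_isotypic (bigD1 0) //= (bigD1 i1) //= big1 ?addr0 // => i /andP[i0 ii1].
  by apply: (isotypic_norm_eq0 uR); apply: Qu.
have -> : isotypic 0 u t = 2 * K / N.
  rewrite /isotypic irr0 cfun11 mul1r NE' mulrC; congr (_ / _).
  rewrite -[K]alK -sumf mulr_sumr.
  by apply: eq_bigr => s _; rewrite cfun1E inE mulr1 uE; ring.
have -> : isotypic i1 u t = m / N * (2 * ((\sum_(s in A) nfix (s^-1 * t)%g)%:R - K)).
  rewrite /isotypic NE' chi1E nfix1; congr (_ / _ * _).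
    by rewrite /m -[in LHS](prednK n0) -natr1 addrK.
  rewrite -[K]alK -sumf natr_sum [X in 2 * (X - _)]big_mkcond /= -sumrB.
  rewrite mulr_sumr; apply: eq_bigr => s _; rewrite uE chi1E /f; case: (s \in A) => /=; ring.
rewrite uE => e; apply: (mulfI (_ : 2 != 0 :> algC)); first by rewrite pnatr_eq0.
rewrite mulrCA e -/N -/K -/m; field; exact: lt0r_neq0.
Qed.

Lemma cross_star n (A B : {set 'S_n}) : (5 <= n)%N -> cross_intersecting A B ->
    (#|A| * #|B| = n.-1`! ^ 2)%N ->
  exists i j : 'I_n, A = star i j /\ B = star i j.
Proof.
move=> n5 AB cAB; have [<- cA Aeq] := cross_extremal n5 AB cAB.
suff [i [j e]] : exists i j, A = star i j by exists i, j.
pose w i j : int := #|[set s in A | s i == j]|.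
case: n n5 => // -[|k] // k5 in A B AB cAB cA Aeq w *.
(* With [n = k.+2], [Aeq] gives the sum [(n - 1)! - (n - 2)! = k * k!] off [A], and
   [n (n - 2)! = k.+2 * k!] more on [A]. Each row of [w] sums to [#|A|]. *)
apply: (@star_of_two_valued _ A w (k * k`!)%N%:Z (k.+2 * k`!)%N%:Z) => //.
- by rewrite eqz_nat -lt0n muln_gt0 fact_gt0.
- move=> t; have := Aeq t; rewrite sum_nfix_mulVg /=.
  have -> : \sum_i w i (t i) = (\sum_i #|[set s in A | s i == t i]|)%N%:Z.
    by rewrite -[RHS]natz natr_sum; apply: eq_bigr => i _; rewrite natz.
  move: (\sum_i _)%N => S e; apply/eqP.
  have : k.+1%:R * S%:R = k.+1%:R * (k * k`! + k.+2 * k`! * (t \in A))%N%:R :> algC.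
    have -> : k.+1%:R * S%:R = k.+2`!%:R * (t \in A)%:R - k.+1`!%:R + k.+1%:R * k.+1`!%:R :> algC.
      by rewrite e; ring.
    rewrite !factS !natrD !natrM -!natr1; ring.
  move/(mulfI (_ : k.+1%:R != 0)); rewrite pnatr_eq0 => /(_ isT) /eqP; rewrite eqr_nat => /eqP ->.
  by rewrite PoszD; case: (t \in A); rewrite ?muln1 ?muln0 ?mulr1n ?mulr0n.
rewrite (eq_bigr (fun=> (k.+1)`!%:Z)).
  by rewrite sumr_const card_ord factS; lia.
move=> i _; rewrite -cA.
have -> : #|A| = (\sum_j #|[set s in A | s i == j]|)%N.
  rewrite -sum1_card (partition_big (fun s : 'S_ _ => s i) predT) //=.
  by apply: eq_bigr => j _; rewrite sum1_card; apply: eq_card => s; rewrite !inE.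
by rewrite -[RHS]natz natr_sum; apply: eq_bigr => j _; rewrite natz.
Qed.

Local Close Scope ring_scope.

Theorem theorem4 (n : nat) (A B : {set {perm 'I_n}}) :
  4 <= n ->
  cross_intersecting A B ->
  #|A| * #|B| = (n.-1)`! ^ 2 ->
  exists i j : 'I_n, A = star i j /\ B = star i j.
Proof.
rewrite leq_eqVlt => /orP[/eqP e|n5]; last exact: cross_star.
by case: n / e A B => A B AB cAB; apply: cross4.
Qed.
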